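(* Fix $\alpha>0$. As $\Gamma\to\infty$, each of the following three upper bounds on $F_\alpha(\Gamma)$ has the form $\alpha\log(\Gamma)+c_{\alpha}+o(1)$: (i) the channel coding converse bound $\min\{2E_0(\alpha,\Gamma),\gamma_\alpha\Gamma\}$, with $c_\alpha=\alpha-(1+\alpha)\log(1+\alpha)$; (ii) the spherical cap bound (equal to $\gamma_\alpha\Gamma$ for $\Gamma<\alpha/\gamma_\alpha$ and to $\alpha[\log(\gamma_\alpha\Gamma/\alpha)+1]$ for $\Gamma\ge\alpha/\gamma_\alpha$), with $c_\alpha=\alpha\log(\gamma_\alpha/\alpha)+\alpha$; (iii) for $\alpha\ge2$, the spectrum replication bound $\gamma_{\alpha}\Gamma-[\alpha\Lambda_{\alpha}(\Gamma)]_{+}$, with $c_\alpha=\alpha\log(e/8)$. Moreover, for $\alpha<2$, when $\gamma_\alpha$ in the spectrum replication bound is replaced by the upper bound $\bar\gamma_\alpha$ below, the resulting bound increases linearly with $\Gamma$ as $\Gamma\to\infty$.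
   Context: $\Gamma>0$ is the SNR, $F_\alpha(\Gamma)$ is the optimal MP$\alpha$E exponent per unit bandwidth for conveying a parameter $u\in[0,1)$ over a band-limited AWGN channel (largest achievable exponent of $\sup_u\mathbb{E}_u|\hat u-u|^\alpha$ divided by the bandwidth $W$, with $\Gamma=P/(N_0W)$), and $\gamma_\alpha=\lim_{\Gamma\to0}F_\alpha(\Gamma)/\Gamma$ is the unlimited-bandwidth MP$\alpha$E exponent; for $\alpha\ge2$ one has $\gamma_\alpha=\frac{\alpha}{2(1+\alpha)}$. Definitions: $E_{0}(\rho,\Gamma)=\frac{1}{2}\left[(1-\beta_{0})(1+\rho)+\Gamma+\log\left(\beta_{0}-\frac{\Gamma}{1+\rho}\right)+\rho\log(\beta_{0})\right]$ with $\beta_{0}=\frac{1}{2}\left(1+\frac{\Gamma}{1+\rho}\right)\left[1+\sqrt{1-\frac{4\Gamma\rho}{(1+\rho+\Gamma)^{2}}}\right]$; $[t]_+=\max\{t,0\}$, $\Lambda_{\alpha}(\Gamma)=\sup_{0<\rho\leq1}\frac{\Phi(\rho,\Gamma)-\gamma_{\alpha}\Gamma}{\rho}$, $\Phi(\rho,\Gamma)=\rho[\eta-1-\log\eta]+\eta+\Gamma+\log\left[\frac{\sqrt{4\eta\Gamma+1}+1}{2\eta}\right]-\sqrt{4\eta\Gamma+1}$ with $\eta=\frac{\Gamma+\sqrt{\Gamma^{2}-4(\rho^{2}+1)(\rho+1)^{2}}}{2(\rho+1)^{2}}$. The upper bound $\bar\gamma_\alpha\ge\gamma_\alpha$ is: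 $\bar\gamma_\alpha=\frac{1}{1+\alpha}\min\{\alpha,\psi(\alpha)\}$ for $0<\alpha\le\alpha_0$; $\bar\gamma_\alpha=\frac{\alpha}{2(1+\alpha)}\left[1+\frac{\alpha+5-4\sqrt{\alpha+1}}{3\alpha+1}\right]$ for $\alpha_0\le\alpha\le2$; $\bar\gamma_\alpha=\frac{\alpha}{2(1+\alpha)}$ for $\alpha\ge2$, where $\alpha_0\approx1.5875$ is the unique root of $\alpha^2-(\alpha-1)\sqrt{\alpha+1}-2=0$ and $\psi(\alpha)=1+\alpha-\max_{q\ge1/2}[2\alpha q+4q\sqrt{(1-q)q(1+\alpha)}-q^2(3\alpha+1)]$. Logarithms are natural. *)

(* Defs.v *)
From HB Require Import structures.
From mathcomp Require Import all_boot all_order all_algebra.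
From mathcomp Require Import all_classical all_reals all_analysis.
Set Implicit Arguments. Unset Strict Implicit. Unset Printing Implicit Defensive.
Import Order.TTheory GRing.Theory Num.Theory.
Import numFieldNormedType.Exports.
Local Open Scope classical_set_scope.
Local Open Scope ring_scope.

Section Defs.
Variable R : realType.
Implicit Types (rho G alpha gam q : R).

Definition beta0 rho G : R :=
  2^-1 * (1 + G / (1 + rho)) *
  (1 + Num.sqrt (1 - 4 * G * rho / (1 + rho + G) ^+ 2)).

Definition E0 rho G : R :=
  2^-1 * ((1 - beta0 rho G) * (1 + rho) + G
          + ln (beta0 rho G - G / (1 + rho)) + rho * ln (beta0 rho G)).

Definition cc_bound alpha gam G : R := Num.min (2 * E0 alpha G) (gam * G).

Definition sc_bound alpha gam G : R :=
  if G < alpha / gam then gam * G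
  else alpha * (ln (gam * G / alpha) + 1).

Definition eta rho G : R :=
  (G + Num.sqrt (G ^+ 2 - 4 * (rho ^+ 2 + 1) * (rho + 1) ^+ 2))
  / (2 * (rho + 1) ^+ 2).

Definition Phi rho G : R :=
  rho * (eta rho G - 1 - ln (eta rho G)) + eta rho G + G
  + ln ((Num.sqrt (4 * eta rho G * G + 1) + 1) / (2 * eta rho G))
  - Num.sqrt (4 * eta rho G * G + 1).

Definition Lambda gam G : R :=
  sup [set (Phi rho G - gam * G) / rho | rho in `]0, 1]].

Definition sr_bound alpha gam G : R :=
  gam * G - Num.max (alpha * Lambda gam G) 0.

Definition psi alpha : R :=
  1 + alpha -
  sup [set 2 * alpha * q + 4 * q * Num.sqrt ((1 - q) * q * (1 + alpha))
           - q ^+ 2 * (3 * alpha + 1) | q in `[2^-1, 1]].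

Definition alpha0_eq a0 : R := a0 ^+ 2 - (a0 - 1) * Num.sqrt (a0 + 1) - 2.

Definition gamma_bar a0 alpha : R :=
  if alpha <= a0 then (1 + alpha)^-1 * Num.min alpha (psi alpha)
  else if alpha <= 2 then
    alpha / (2 * (1 + alpha)) *
    (1 + (alpha + 5 - 4 * Num.sqrt (alpha + 1)) / (3 * alpha + 1))
  else alpha / (2 * (1 + alpha)).

End Defs.

(* Main.v *)
Require Import Defs.
From HB Require Import structures.
From mathcomp Require Import all_boot all_order all_algebra.
From mathcomp Require Import all_classical all_reals all_analysis.
From mathcomp Require Import ring lra.
Import Order.TTheory GRing.Theory Num.Theory.
Import numFieldNormedType.Exports.
Local Open Scope classical_set_scope.
Local Open Scope ring_scope.
Set Implicit Arguments.
Unset Strict Implicit.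
Unset Printing Implicit Defensive.

(** For the channel coding bound, [beta0 - G / (1 + a)] tends to [1 / (1 + a)],
    and [E0] is a continuous expression in it. For the spectrum replication
    bound, since [eta = G / (1 + r)^2 - O(1 / G)], one has uniformly in
    [0 < r <= 1]
      [Phi r G = G r / (1 + r) - r - r ln G + (2 r + 1) ln (1 + r) + O(1 / G)].
    When [gam >= 1/3] the supremum defining [Lambda] is therefore attained at
    [r = 1] up to [O(1 / G)], and for [gam = alpha / (2 (1 + alpha))] the terms
    linear in [G] cancel. In general
    [Lambda gam G / G] tends to [sup_r (1 / (1 + r) - gam / r)], so that
    [sr_bound alpha gam G / G] has a limit, which is positive as soon as [gam]
    exceeds [alpha / (1 + sqrt alpha)^2] (if [alpha < 1]) or
    [alpha / (2 (1 + alpha))] (if [1 <= alpha]). The estimate [q (1 - q) <= 1/4]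
    in [psi] gives, with [s = sqrt (1 + alpha)],
      [gamma_bar >= alpha (2 alpha + 3 - 2 s) / ((3 alpha + 1) (1 + alpha))]
    on both branches below [alpha = 2], which exceeds these thresholds. *)

(** * Explicit bounds on [eta] and [Phi], uniform in [0 < r <= 1] *)

Section Elementary.
Context {R : realType}.
Implicit Types (a b r G : R).

Lemma ler_sqrtr_of_sqr a b : a ^+ 2 <= b -> a <= Num.sqrt b.
Proof.
by move=> ab; apply: (le_trans (ler_norm a)); rewrite -sqrtr_sqr ler_wsqrtr.
Qed.

Lemma sqrtr_ler_of_sqr a b : 0 <= a -> b <= a ^+ 2 -> Num.sqrt b <= a.
Proof.
by move=> a0 ba; rewrite -[leRHS](ger0_norm a0) -sqrtr_sqr ler_wsqrtr.
Qed.

Lemma ln_le_sub1 a : 0 < a -> ln a <= a - 1.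
Proof. by move=> a0; have := @le_ln1Dx R (a - 1); rewrite subrKC; apply; lra. Qed.

(** Comparing squares places the square root between [G - 8 * m ^+ 2 / G] and [G]: as
    [r ^+ 2 + 1 <= 2], the loss under the root is at most [8 * m ^+ 2], and [8 <= G] absorbs the
    second-order term. *)
Lemma eta_bounds r G : 0 < r -> r <= 1 -> 8 <= G ->
  G / (1 + r) ^+ 2 - 4 / G <= Defs.eta r G <= G / (1 + r) ^+ 2.
Proof.
move=> r0 r1 G8; rewrite /Defs.eta ![r + 1]addrC.
set m := 1 + r; set D := Num.sqrt _.
have m1 : 1 < m by rewrite /m; lra.
have m2 : m <= 2 by rewrite /m; lra.
have mm0 : 0 < m ^+ 2 by nra.
have mm4 : m ^+ 2 <= 4 by nra.
have rr : 0 < r ^+ 2 <= 1 by nra.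
set v := G^-1.
have vG : v * G = 1 by rewrite /v mulVf//; lra.
have v0 : 0 < v by rewrite /v invr_gt0; lra.
have v8 : v <= 1 / 8 by nra.
have DG : D <= G.
  apply: sqrtr_ler_of_sqr; first lra.
  have : 0 <= (r ^+ 2 + 1) * m ^+ 2 by nra.
  lra.
have GD : G - 8 * m ^+ 2 * v <= D.
  apply: ler_sqrtr_of_sqr.
  have -> : (G - 8 * m ^+ 2 * v) ^+ 2 =
    G ^+ 2 - 16 * m ^+ 2 * (v * G) + 64 * (m ^+ 2 * v) ^+ 2 by ring.
  rewrite vG.
  have : (m ^+ 2 * v) ^+ 2 <= m ^+ 2 * (4 / 64).
    have -> : (m ^+ 2 * v) ^+ 2 = m ^+ 2 * (m ^+ 2 * (v * v)) by ring.
    rewrite ler_pM2l//; have : v * v <= 1 / 64 by nra.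
    nra.
  have : r ^+ 2 * m ^+ 2 <= m ^+ 2 by nra.
  lra.
have -> : G / m ^+ 2 = (G + G) / (2 * m ^+ 2) by field; lra.
have -> : 4 / G = (8 * m ^+ 2 * v) / (2 * m ^+ 2) by rewrite /v; field; lra.
have mV0 : 0 < (2 * m ^+ 2)^-1 by rewrite invr_gt0; lra.
rewrite -mulrBl !(ler_pM2r mV0).
by apply/andP; split; lra.
Qed.

Definition Phi_asympt r G : R :=
  G - G / (1 + r) - r - r * ln G + (2 * r + 1) * ln (1 + r).

Lemma Phi_bounds r G : 0 < r -> r <= 1 -> 8 <= G ->
  Phi_asympt r G - G^-1 <= Phi r G <= Phi_asympt r G + 24 * G^-1.
Proof.
move=> r0 r1 G8; have /andP[] := eta_bounds r0 r1 G8.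
rewrite /Phi_asympt /Phi; set e := Defs.eta r G; set m := 1 + r.
set S := Num.sqrt (4 * e * G + 1).
set x := G / m ^+ 2; set v := G^-1 => xe ex.
have m1 : 1 < m by rewrite /m; lra.
have m2 : m <= 2 by rewrite /m; lra.
have mm0 : 0 < m ^+ 2 by nra.
have mm4 : m ^+ 2 <= 4 by nra.
have vG : v * G = 1 by rewrite /v mulVf//; lra.
have v0 : 0 < v by rewrite /v invr_gt0; lra.
have v8 : v <= 1 / 8 by nra.
have Gx : G = x * m ^+ 2 by rewrite /x divfK//; lra.
have x0 : 0 < x by rewrite /x divr_gt0//; lra.
have xG : G / 4 <= x by rewrite Gx; nra.
have eG : G / 8 <= e by lra.
have e0 : 0 < e by lra.
have ev : e^-1 <= 8 * v.
  rewrite -[e^-1]mul1r ler_pdivrMr//.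
  have : v * (G / 8) <= v * e by rewrite ler_pM2l.
  lra.
have Gm : G / m = m * x by rewrite Gx; field; lra.
have lnx : ln x = ln G - 2 * ln m.
  rewrite /x ln_div ?posrE//; last lra.
  by rewrite lnXn ?mulr_natl//; lra.
have S_ge : 2 * m * e <= S.
  apply: ler_sqrtr_of_sqr.
  have : m ^+ 2 * e <= G by rewrite Gx mulrC ler_pM2r.
  have -> : (2 * m * e) ^+ 2 = 4 * e * (m ^+ 2 * e) by ring.
  move=> h; have : e * (m ^+ 2 * e) <= e * G by rewrite ler_pM2l.
  lra.
(* An error of constant order suffices inside the logarithm, where [S] is divided by [e], of order
   [G]. The term [- S] of [Phi] needs the sharper [S_le]. *)
have S_lex : S <= 2 * m * x + 1.
  apply: sqrtr_ler_of_sqr; first nra.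
  have : e * G <= m ^+ 2 * x * x by rewrite Gx; nra.
  have : 0 < m * x by nra.
  have -> : (2 * m * x + 1) ^+ 2 =
    4 * (m ^+ 2 * x * x) + 4 * (m * x) + 1 by ring.
  lra.
(* AM-GM for the product [e * G], with factors [m * e] and [G / m] so that [m * e] cancels against
   [r * e + e] in [Phi]. The term [v] pays for the [+ 1] under the root. *)
have S_le : S <= m * e + G / m + v.
  rewrite Gm; have mx : 0 < m * x by nra.
  have me : 0 < m * e by nra.
  apply: sqrtr_ler_of_sqr; first lra.
  have -> : (m * e + m * x + v) ^+ 2 = (m * e - m * x) ^+ 2
     + 4 * e * (x * m ^+ 2) + v ^+ 2 + 2 * (m * e) * v + 2 * (v * (m * x)) by ring.
  have : 1 <= 2 * (v * (m * x)).
    have -> : v * (m * x) = m^-1 by rewrite -Gm mulrA vG mul1r.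
    have : 2^-1 <= m^-1 by rewrite lef_pV2 ?posrE//; lra.
    lra.
  rewrite -Gx; have := sqr_ge0 (m * e - m * x); have := sqr_ge0 v.
  nra.
have lne_le : ln e <= ln x by rewrite ler_ln ?posrE.
have lne_ge : ln x <= ln e + 32 * (v * v).
  have : ln (x / e) <= x / e - 1 by apply/ln_le_sub1/divr_gt0.
  rewrite ln_div ?posrE//.
  have : x / e - 1 <= 4 * v * e^-1.
    have -> : x / e - 1 = (x - e) / e by field; lra.
    by rewrite ler_pM2r ?invr_gt0//; lra.
  nra.
have q_ge : m <= (S + 1) / (2 * e) by rewrite ler_pdivlMr; lra.
have q_le : (S + 1) / (2 * e) <= m * (1 + 12 * v).
  rewrite ler_pdivrMr; last lra.
  have : 1 + 4 * v <= 12 * v * e by nra.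
  have : m * x <= m * (e + 4 * v) by rewrite ler_pM2l; lra.
  nra.
have lnq_ge : ln m <= ln ((S + 1) / (2 * e)) by rewrite ler_ln ?posrE; lra.
have lnq_le : ln ((S + 1) / (2 * e)) <= ln m + 12 * v.
  apply: (@le_trans _ _ (ln (m * (1 + 12 * v)))).
    by rewrite ler_ln ?posrE//; nra.
  rewrite lnM ?posrE; [|lra|lra].
  have : ln (1 + 12 * v) <= 12 * v by apply: le_ln1Dx; lra.
  lra.
apply/andP; split.
  have : r * ln e <= r * ln x by rewrite ler_pM2l.
  rewrite lnx /m in S_le lnq_ge * => h; move: (ln G) (ln (1 + r)) h lnq_ge.
  by move=> *; lra.
(* The constant 24 is 4 from [ln e], 8 from [m * e] and 12 from the logarithm of the quotient. *)
have : r * ln x <= r * ln e + 4 * v.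
  have : r * ln x <= r * (ln e + 32 * (v * v)) by rewrite ler_pM2l.
  have : r * (v * v) <= v / 8 by nra.
  lra.
have : m * x - m * e <= 8 * v by nra.
rewrite lnx Gm => h1 h2; move: h1 h2 S_ge lnq_le; rewrite /m.
by move: (ln _) (ln (1 + r)) => *; lra.
Qed.

End Elementary.

(** * Limits at infinity; the channel coding and spherical cap bounds *)

Section Limits.
Context {R : realType}.
Implicit Types (a c K G l : R).

Lemma cvg_invr_pinfty : (fun G : R => G^-1) @ +oo --> (0 : R).
Proof.
apply/gtr0_cvgV0; last exact: cvg_id.
by apply: nbhs_pinfty_gt; rewrite num_real.
Qed.

(** [ln G] is twice the logarithm of the square root of [G], hence less than twice that root. *)
Lemma cvg_ln_div_pinfty : (ln G / G) @[G --> +oo] --> (0 : R).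
Proof.
apply/cvgr0Pnorm_le => e e0; near=> G.
have G1 : 1 <= G by near: G; apply: nbhs_pinfty_ge; rewrite num_real.
have Ge : (2 / e) ^+ 2 <= G by near: G; apply: nbhs_pinfty_ge; rewrite num_real.
have G0 : 0 < G by lra.
have s0 : 0 < Num.sqrt G by rewrite sqrtr_gt0.
have sG : Num.sqrt G ^+ 2 = G by rewrite sqr_sqrtr// ltW.
have es : 2 <= e * Num.sqrt G.
  by rewrite mulrC -ler_pdivrMr//; apply: ler_sqrtr_of_sqr.
rewrite ger0_norm; last by rewrite divr_ge0 ?ln_ge0// ltW.
rewrite ler_pdivrMr//.
rewrite -sG lnXn// -mulr_natl.
have : ln (Num.sqrt G) < Num.sqrt G by apply: ln_sublinear.
nra.
Unshelve. all: by end_near. Qed.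

Lemma near_ln_affine_le a K c : 0 < c ->
  \forall G \near +oo, a * ln G + K <= c * G.
Proof.
move=> c0.
have /cvgr_le h : (a * (ln G / G) + K * G^-1) @[G --> +oo] --> a * 0 + K * 0.
  by apply: cvgD; apply: cvgMr; [exact: cvg_ln_div_pinfty|exact: cvg_invr_pinfty].
near=> G.
have G0 : 0 < G by near: G; apply: nbhs_pinfty_gt; rewrite num_real.
have -> : a * ln G + K = (a * (ln G / G) + K * G^-1) * G by field; lra.
rewrite ler_pM2r//; near: G; apply: h; lra.
Unshelve. all: by end_near. Qed.

Lemma cvg_of_bound_invr (f : R -> R) l K :
  (\forall G \near +oo, `|f G - l| <= K * G^-1) -> f G @[G --> +oo] --> l.
Proof.
move=> h; apply/cvgrPdist_le => e e0.
have /cvgr_le hK : (K * G^-1) @[G --> +oo] --> K * 0.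
  by apply: cvgMr; exact: cvg_invr_pinfty.
near=> G; rewrite distrC (@le_trans _ _ (K * G^-1))//; first by near: G.
by near: G; apply: hK; rewrite mulr0.
Unshelve. all: by end_near. Qed.

Lemma beta0_bounds a G : 0 < a -> a <= G ->
  (1 + a)^-1 <= beta0 a G - G / (1 + a) <=
  (1 + a)^-1 + a / ((1 + a) * (G + 1 - a)).
Proof.
move=> a0 aG; rewrite /beta0; set q := Num.sqrt _.
have n0 : 0 < 1 + a by lra.
have nG0 : 0 < 1 + a + G by lra.
have u0 : 0 < G + 1 - a by lra.
(* With [u = G + 1 - a], the root of [u ^+ 2 + 4 * a] lies between [u] and [u + 2 * a / u]. *)
have disc : 1 - 4 * G * a / (1 + a + G) ^+ 2 =
    ((G + 1 - a) ^+ 2 + 4 * a) / (1 + a + G) ^+ 2 by field; lra.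
have nG2 : 0 < (1 + a + G) ^+ 2 by rewrite exprn_gt0.
have q_ge : (G + 1 - a) / (1 + a + G) <= q.
  apply: ler_sqrtr_of_sqr; rewrite disc expr_div_n ler_pM2r ?invr_gt0//; lra.
have q_le : q <= (G + 1 - a + 2 * a / (G + 1 - a)) / (1 + a + G).
  apply: sqrtr_ler_of_sqr.
    have : 0 < 2 * a / (G + 1 - a) by apply: divr_gt0 => //; lra.
    by move=> ?; apply: divr_ge0; lra.
  rewrite disc expr_div_n ler_pM2r ?invr_gt0//.
  have -> : (G + 1 - a + 2 * a / (G + 1 - a)) ^+ 2 =
    (G + 1 - a) ^+ 2 + 4 * a + (2 * a / (G + 1 - a)) ^+ 2 by field; lra.
  by rewrite lerDl sqr_ge0.
have -> : 2^-1 * (1 + G / (1 + a)) * (1 + q) - G / (1 + a) =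
  (1 + a + G) / (2 * (1 + a)) * q + (1 + a - G) / (2 * (1 + a)) by field; lra.
have k0 : 0 < (1 + a + G) / (2 * (1 + a)) by rewrite divr_gt0//; lra.
have : (1 + a + G) / (2 * (1 + a)) * ((G + 1 - a) / (1 + a + G)) <=
  (1 + a + G) / (2 * (1 + a)) * q by rewrite ler_pM2l.
have : (1 + a + G) / (2 * (1 + a)) * q <= (1 + a + G) / (2 * (1 + a)) *
  ((G + 1 - a + 2 * a / (G + 1 - a)) / (1 + a + G)) by rewrite ler_pM2l.
set lo := _ * ((G + 1 - a) / _); set hi := _ * (_ / (1 + a + G)).
have -> : (1 + a)^-1 = lo + (1 + a - G) / (2 * (1 + a)) by rewrite /lo; field; lra.
have -> : lo + (1 + a - G) / (2 * (1 + a)) + a / ((1 + a) * (G + 1 - a)) =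
  hi + (1 + a - G) / (2 * (1 + a)) by rewrite /lo /hi; field; lra.
by move=> *; apply/andP; split; lra.
Qed.

Lemma cvg_beta0_sub a : 0 < a ->
  (beta0 a G - G / (1 + a)) @[G --> +oo] --> (1 + a)^-1.
Proof.
move=> a0; apply: (@cvg_of_bound_invr _ _ 2); near=> G.
have G1 : 1 <= G by near: G; apply: nbhs_pinfty_ge; rewrite num_real.
have aG : 2 * a <= G by near: G; apply: nbhs_pinfty_ge; rewrite num_real.
have /andP[lo hi] : (1 + a)^-1 <= beta0 a G - G / (1 + a) <=
  (1 + a)^-1 + a / ((1 + a) * (G + 1 - a)) by apply: beta0_bounds; lra.
rewrite ger0_norm; last lra.
suff : a / ((1 + a) * (G + 1 - a)) <= 2 * G^-1 by lra.
rewrite ler_pdivrMr; last by rewrite mulr_gt0//; lra.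
rewrite mulrAC ler_pdivlMr; nra.
Unshelve. all: by end_near. Qed.

(** In terms of [d], the summand [G] of [E0] cancels against [(1 + a) * (G / (1 + a))], and
    [ln (beta0 a G) - ln G] becomes [ln (d G / G + (1 + a)^-1)]. *)
Lemma cvg_E0 a : 0 < a ->
  (2 * E0 a G - a * ln G) @[G --> +oo] --> a - (1 + a) * ln (1 + a).
Proof.
move=> a0; have n0 : 0 < 1 + a by lra.
set d := fun G => beta0 a G - G / (1 + a).
have dc : d G @[G --> +oo] --> (1 + a)^-1 by exact: cvg_beta0_sub.
have nV : 0 < (1 + a)^-1 by rewrite invr_gt0.
have lnd : ln (d G) @[G --> +oo] --> ln (1 + a)^-1.
  exact: (continuous_cvg _ (continuous_ln nV) dc).
have lnb : ln (d G * G^-1 + (1 + a)^-1) @[G --> +oo] --> ln (1 + a)^-1.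
  have h : (d G * G^-1 + (1 + a)^-1) @[G --> +oo] --> (1 + a)^-1.
    rewrite -[X in _ --> X]add0r -[X in _ --> X + _](mulr0 (1 + a)^-1).
    by apply: cvgD; [exact: cvgM dc cvg_invr_pinfty|exact: cvg_cst].
  exact: (continuous_cvg _ (continuous_ln nV) h).
have -> : a - (1 + a) * ln (1 + a) =
  (1 + a) - (1 + a) * (1 + a)^-1 + ln (1 + a)^-1 + a * ln (1 + a)^-1.
  rewrite lnV ?posrE// divff; [ring|lra].
have : ((1 + a) - (1 + a) * d G + ln (d G) + a * ln (d G * G^-1 + (1 + a)^-1))
    @[G --> +oo] -->
  (1 + a) - (1 + a) * (1 + a)^-1 + ln (1 + a)^-1 + a * ln (1 + a)^-1.
  apply: cvgD; last exact: cvgMr.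
  apply: cvgD => //; apply: cvgB; first exact: cvg_cst.
  exact: cvgMr.
apply: cvg_trans; apply: near_eq_cvg; near=> G.
have G1 : 1 <= G by near: G; apply: nbhs_pinfty_ge; rewrite num_real.
have aG : a <= G by near: G; apply: nbhs_pinfty_ge; rewrite num_real.
have /andP[dlo _] := beta0_bounds a0 aG.
have Gn : 0 < G / (1 + a) by rewrite divr_gt0//; lra.
have -> : d G * G^-1 + (1 + a)^-1 = beta0 a G / G.
  by rewrite /d; field; lra.
rewrite ln_div ?posrE; [|lra|lra].
by rewrite /d /E0; field; lra.
Unshelve. all: by end_near. Qed.

(** The first argument of the minimum grows logarithmically, so it is eventually the smaller one. *)
Lemma cvg_cc_bound a c : 0 < a -> 0 < c ->
  (cc_bound a c G - a * ln G) @[G --> +oo] --> a - (1 + a) * ln (1 + a).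
Proof.
move=> a0 c0; have hE := cvg_E0 a0.
apply: cvg_trans hE; apply: near_eq_cvg.
have /cvgr_le hE := cvg_E0 a0.
near=> G; rewrite /cc_bound min_l//.
have : 2 * E0 a G - a * ln G <= a - (1 + a) * ln (1 + a) + 1.
  by near: G; apply: hE; lra.
have : a * ln G + (a - (1 + a) * ln (1 + a) + 1) <= c * G.
  by near: G; apply: near_ln_affine_le.
lra.
Unshelve. all: by end_near. Qed.

Lemma cvg_sc_bound a c : 0 < a -> 0 < c ->
  (sc_bound a c G - a * ln G) @[G --> +oo] --> a * ln (c / a) + a.
Proof.
move=> a0 c0; apply: cvg_near_cst; near=> G.
have G0 : 0 < G by near: G; apply: nbhs_pinfty_gt; rewrite num_real.
rewrite /sc_bound ltNge.
have -> : a / c <= G by near: G; apply: nbhs_pinfty_ge; rewrite num_real.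
have -> : c * G / a = c / a * G by field; lra.
by rewrite /= lnM ?posrE ?divr_gt0//; ring.
Unshelve. all: by end_near. Qed.

End Limits.

(** * The spectrum replication bound, with exact and with replaced slope *)

Section SpectrumReplication.
Context {R : realType}.
Implicit Types (a c r q G K : R).

Lemma Lambda_le c G K :
  (forall r, 0 < r -> r <= 1 -> Phi r G - c * G <= r * K) -> Lambda c G <= K.
Proof.
move=> h; apply: ge_sup; first by exists ((Phi 1 G - c * G) / 1);
  exists 1 => //=; rewrite in_itv/= ltr01 lexx.
move=> _ [r /= + <-]; rewrite in_itv/= => /andP[r0 r1].
by rewrite ler_pdivrMr// [leRHS]mulrC h.
Qed.

(** The hypothesis on [K] bounds the set above; on an unbounded set [sup] would be a default
    value. *)
Lemma le_Lambda c G K r :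
  (forall r, 0 < r -> r <= 1 -> Phi r G - c * G <= r * K) ->
  0 < r -> r <= 1 -> (Phi r G - c * G) / r <= Lambda c G.
Proof.
move=> h r0 r1; apply: ub_le_sup; last by exists r => //=; rewrite in_itv/= r0.
exists K => _ [t /= + <-]; rewrite in_itv/= => /andP[t0 t1].
by rewrite ler_pdivrMr// [leRHS]mulrC h.
Qed.

(** The lower bound is the value at [r = 1]. The constant [1 / 3] is [a / (2 * (1 + a))] at
    [a = 2]. *)
Lemma Lambda_bounds c G : 1 / 3 <= c -> 48 <= G ->
  (2^-1 - c) * G - 1 - ln G + 3 * ln 2 - G^-1 <= Lambda c G <=
  (2^-1 - c) * G - 1 - ln G + 3 * ln 2 + 48 * G^-1.
Proof.
move=> c3 G48; set v := G^-1.
have G8 : 8 <= G by lra.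
have vG : v * G = 1 by rewrite /v mulVf//; lra.
have v0 : 0 < v by rewrite /v invr_gt0; lra.
have v48 : v <= 1 / 48 by nra.
have ln2_le1 : ln (2 : R) <= 1.
  have : ln (2 : R) <= 2 - 1 by apply: ln_le_sub1; lra.
  lra.
have ub r : 0 < r -> r <= 1 -> Phi r G - c * G <=
    r * ((2^-1 - c) * G - 1 - ln G + 3 * ln 2 + 48 * v).
  move=> r0 r1.
  have : Phi r G <= Phi_asympt r G + 24 * v.
    by have /andP[] := Phi_bounds r0 r1 G8.
  rewrite /Phi_asympt.
  have lnr : ln (1 + r) <= ln 2 by rewrite ler_ln ?posrE; lra.
  have -> : G - G / (1 + r) = G * (r / (1 + r)) by field; lra.
  (* Tangent at [r = 1] to a concave function. Its excess [G * (1 - r) / 4] is beaten by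
     [c * G * (1 - r)], with at least [G * (1 - r) / 12] left to absorb the other multiples of
     [1 - r]. *)
  have rr : r / (1 + r) <= r / 2 + (1 - r) / 4.
    by rewrite ler_pdivrMr; [nra|lra].
  have : G * (r / (1 + r)) <= G * (r / 2 + (1 - r) / 4) by rewrite ler_pM2l; lra.
  have : (2 * r + 1) * ln (1 + r) <= (2 * r + 1) * ln 2 by rewrite ler_pM2l; lra.
  have : (1 - r) * ln 2 <= 1 - r by nra.
  have : G * (1 - r) * (1 / 3) <= G * (1 - r) * c by rewrite ler_wpM2l//; nra.
  have : 48 * (1 - r) <= G * (1 - r) by nra.
  have : v * (1 - r) <= 1 / 48 * (1 - r) by nra.
  move: (ln G) (ln 2) (ln (1 + r)) (r / (1 + r)) (Phi r G) => *.
  lra.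
apply/andP; split; last exact: Lambda_le.
have h1 := le_Lambda ub ltr01 (lexx 1); apply: le_trans h1.
have /andP[+ _] := Phi_bounds ltr01 (lexx 1) G8.
rewrite /Phi_asympt -/v divr1 (_ : 1 + 1 = 2); last lra.
by move: (ln G) (ln 2) (Phi 1 G) => *; lra.
Qed.

Lemma cvg_sr_bound a : 2 <= a ->
  (sr_bound a (a / (2 * (1 + a))) G - a * ln G) @[G --> +oo]
    --> a * ln (expR 1 / 8).
Proof.
move=> a2; set c := a / _.
have c3 : 1 / 3 <= c by rewrite /c ler_pdivlMr; lra.
have c2 : 0 < 2^-1 - c.
  have -> : 2^-1 - c = (2 * (1 + a))^-1 by rewrite /c; field; lra.
  by rewrite invr_gt0; lra.
have ca : c = a * (2^-1 - c) by rewrite /c; field; lra.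
have -> : ln (expR 1 / 8) = 1 - 3 * ln 2 :> R.
  rewrite ln_div ?posrE ?expR_gt0//.
  rewrite expRK (_ : 8 = 2 ^+ 3); last by ring.
  by rewrite lnXn ?mulr_natl.
apply: (@cvg_of_bound_invr _ _ _ (48 * a)); near=> G.
have G48 : 48 <= G by near: G; apply: nbhs_pinfty_ge; rewrite num_real.
have /andP[lo hi] := Lambda_bounds c3 G48.
have L0 : 0 <= Lambda c G.
  have : 1 * ln G + 2 <= (2^-1 - c) * G by near: G; exact: near_ln_affine_le.
  have : 0 < ln (2 : R) by apply: ln_gt0; lra.
  have : G^-1 <= 1 by rewrite invf_le1; lra.
  lra.
have v0 : 0 < G^-1 by rewrite invr_gt0; lra.
rewrite /sr_bound max_l; last by apply: mulr_ge0 => //; lra.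
rewrite {1}ca.
have -> : a * (2^-1 - c) * G - a * Lambda c G - a * ln G - a * (1 - 3 * ln 2) =
  a * ((2^-1 - c) * G - Lambda c G - ln G - 1 + 3 * ln 2) by ring.
rewrite normrM gtr0_norm; last lra.
rewrite [48 * a]mulrC -mulrA ler_pM2l; last lra.
by rewrite ler_norml; apply/andP; split; lra.
Unshelve. all: by end_near. Qed.

(* The limit of the objective of [Lambda], divided by [G]. *)
Definition rate c r : R := (1 + r)^-1 - c / r.

Definition Lambda_rate c : R := sup [set rate c r | r in `]0, 1]].

Lemma Lambda_rate_le c K :
  (forall r, 0 < r -> r <= 1 -> rate c r <= K) -> Lambda_rate c <= K.
Proof.
move=> h; apply: ge_sup; first by exists (rate c 1);
  exists 1 => //=; rewrite in_itv/= ltr01 lexx.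
by move=> _ [r /= + <-]; rewrite in_itv/= => /andP[r0 r1]; exact: h.
Qed.

Lemma has_sup_rate c : 0 < c -> has_sup [set rate c r | r in `]0, 1]].
Proof.
move=> c0; split; first by exists (rate c 1);
  exists 1 => //=; rewrite in_itv/= ltr01 lexx.
exists 1 => _ [r /= + <-]; rewrite in_itv/= => /andP[r0 r1].
have : 0 < c / r by rewrite divr_gt0.
have : (1 + r)^-1 <= 1 by rewrite invf_le1; lra.
by rewrite /rate; lra.
Qed.

Lemma le_Lambda_rate c r : 0 < c -> 0 < r -> r <= 1 -> rate c r <= Lambda_rate c.
Proof.
move=> c0 r0 r1; apply: (sup_upper_bound (has_sup_rate c0)).
by exists r => //=; rewrite in_itv/= r0.
Qed.

(* The perturbation [e / r] is harmless for small [r], where [rate c r] is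
   very negative. *)
Lemma rate_perturb_le c e r : 0 < c -> 0 < e -> e <= c / 2 -> 0 < r -> r <= 1 ->
  rate c r + e / r <= Lambda_rate c + e * (2 * (1 + c) / c).
Proof.
move=> c0 e0 ec r0 r1.
have t0 : 0 < 2 * (1 + c) / c by rewrite divr_gt0//; lra.
have [rt|tr] := leP r^-1 (2 * (1 + c) / c).
  have : e * r^-1 <= e * (2 * (1 + c) / c) by rewrite ler_pM2l.
  have := le_Lambda_rate c0 r0 r1.
  lra.
(* Past the threshold, [(c - e) / r >= 1 + c], so the left side is at most [- c], below
   [rate c 1 = 2^-1 - c]. *)
have et : 0 < e * (2 * (1 + c) / c) by rewrite mulr_gt0.
have := le_Lambda_rate c0 ltr01 (lexx 1).
rewrite /rate divr1 (_ : 1 + 1 = 2); last lra.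
have : (1 + r)^-1 <= 1 by rewrite invf_le1; lra.
have : (c - e) * r^-1 >= c / 2 * (2 * (1 + c) / c).
  apply: ler_pM; [lra|lra|lra|exact: ltW].
have -> : c / 2 * (2 * (1 + c) / c) = 1 + c by field; lra.
lra.
Qed.

Lemma cvg_Lambda_div c : 0 < c ->
  (Lambda c G / G) @[G --> +oo] --> Lambda_rate c.
Proof.
move=> c0; apply/cvgrPdist_le => e e0.
have e2 : 0 < e / 2 by lra.
have [_ [r0 /= + <-] Lr0] := sup_adherent e2 (has_sup_rate c0).
rewrite in_itv/= => /andP[r00 r01].
(* The first summand is the cost in [rate_perturb_le] of the error [24 / G] of [Phi]; the 2 is what
   remains of [3 * r - r], where [3 * r] bounds the last term of [Phi_asympt]. *)
pose k := 24 * (2 * (1 + c) / c) + 2.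
near=> G.
have G8 : 8 <= G by near: G; apply: nbhs_pinfty_ge; rewrite num_real.
have G0 : 0 < G by lra.
have v0 : 0 < G^-1 by rewrite invr_gt0.
have v1 : G^-1 <= 1 by rewrite invf_le1; lra.
have lnG0 : 0 <= ln G by apply: ln_ge0; lra.
have Gc : 48 / c <= G by near: G; apply: nbhs_pinfty_ge; rewrite num_real.
have Gk : k / e <= G by near: G; apply: nbhs_pinfty_ge; rewrite num_real.
have Gl : 1 * ln G + (1 + r0^-1) <= e / 2 * G.
  by near: G; exact: near_ln_affine_le.
have vc : 24 * (G^-1 * G^-1) <= c / 2.
  have : 48 <= c * G by rewrite mulrC -ler_pdivrMr.
  move=> h; have : 48 * G^-1 <= c by rewrite ler_pdivrMr.
  nra.
have vk : k * G^-1 <= e by rewrite ler_pdivrMr// mulrC -ler_pdivrMr.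
have ub r : 0 < r -> r <= 1 ->
    Phi r G - c * G <= r * (G * (Lambda_rate c + k * G^-1)).
  move=> rp r1; have /andP[_] := Phi_bounds rp r1 G8.
  have lnr : ln (1 + r) <= r by apply: le_ln1Dx; lra.
  have : (2 * r + 1) * ln (1 + r) <= 3 * r.
    apply: (@le_trans _ _ ((2 * r + 1) * r)); first by rewrite ler_pM2l//; lra.
    nra.
  have : 0 <= r * ln G by rewrite mulr_ge0// ltW.
  have : rate c r + 24 * (G^-1 * G^-1) / r <=
      Lambda_rate c + 24 * (G^-1 * G^-1) * (2 * (1 + c) / c).
    by apply: rate_perturb_le => //; rewrite !mulr_gt0.
  rewrite -(ler_pM2l (mulr_gt0 rp G0)).
  have -> : r * G * (rate c r + 24 * (G^-1 * G^-1) / r) =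
    G - G / (1 + r) - c * G + 24 * G^-1 by rewrite /rate; field; lra.
  have t0 : 0 < 2 * (1 + c) / c by rewrite divr_gt0//; lra.
  have -> : r * G * (Lambda_rate c + 24 * (G^-1 * G^-1) * (2 * (1 + c) / c)) =
    r * (G * Lambda_rate c + 24 * (2 * (1 + c) / c) * G^-1) by field; lra.
  have -> : G * (Lambda_rate c + k * G^-1) = G * Lambda_rate c + k by field; lra.
  have : r * (24 * (2 * (1 + c) / c) * G^-1) <= r * (24 * (2 * (1 + c) / c)).
    rewrite ler_pM2l//; nra.
  rewrite /Phi_asympt /k.
  move: (2 * (1 + c) / c) (ln G) (ln (1 + r)) (Phi r G) (G / (1 + r)) => *.
  lra.
have hi : Lambda c G / G <= Lambda_rate c + e.
  rewrite ler_pdivrMr//; apply: (@le_trans _ _ (G * (Lambda_rate c + k * G^-1))).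
    exact: Lambda_le.
  by rewrite mulrC ler_pM2r//; lra.
have lo : rate c r0 - e / 2 <= Lambda c G / G.
  rewrite ler_pdivlMr//; apply: le_trans (le_Lambda ub r00 r01).
  rewrite ler_pdivlMr//.
  have /andP[+ _] := Phi_bounds r00 r01 G8.
  have l0 : 0 <= ln (1 + r0) by apply: ln_ge0; lra.
  have : 0 <= (2 * r0 + 1) * ln (1 + r0) by apply: mulr_ge0 => //; lra.
  have -> : (rate c r0 - e / 2) * G * r0 =
    G - G / (1 + r0) - c * G - r0 * (e / 2 * G) by rewrite /rate; field; lra.
  have : r0 * (1 * ln G + (1 + r0^-1)) <= r0 * (e / 2 * G) by rewrite ler_pM2l.
  have -> : r0 * (1 * ln G + (1 + r0^-1)) = r0 * ln G + r0 + 1 by field; lra.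
  rewrite /Phi_asympt.
  move: (ln G) (ln (1 + r0)) (Phi r0 G) (G / (1 + r0)) => *.
  lra.
by rewrite ler_norml; apply/andP; split; rewrite /Lambda_rate in hi lo *; lra.
Unshelve. all: by end_near. Qed.

Lemma cvg_sr_bound_div a c : 0 < c ->
  (sr_bound a c G / G) @[G --> +oo] --> c - Num.max (a * Lambda_rate c) 0.
Proof.
move=> c0; have hL := cvg_Lambda_div c0.
rewrite maxr_absE subr0 addr0.
have : (c - (a * (Lambda c G / G) + `|a * (Lambda c G / G)|) / 2) @[G --> +oo]
   --> c - (a * Lambda_rate c + `|a * Lambda_rate c|) / 2.
  have haL : (a * (Lambda c G / G)) @[G --> +oo] --> a * Lambda_rate c.
    exact: cvgMr.
  apply: cvgB; first exact: cvg_cst.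
  by apply: cvgMl; apply: cvgD => //; exact: cvg_norm.
apply: cvg_trans; apply: near_eq_cvg; near=> G.
have G0 : 0 < G by near: G; apply: nbhs_pinfty_gt; rewrite num_real.
rewrite /sr_bound maxr_absE subr0 addr0 mulrA normrM.
rewrite [`|G^-1|]gtr0_norm ?invr_gt0//.
by field; lra.
Unshelve. all: by end_near. Qed.

(** Bounding the root by [s / 2] leaves the concave quadratic
    [2 * (a + s) * q - (3 * a + 1) * q ^+ 2]; completing the square gives its maximum. *)
Lemma sup_psi_le a : 0 < a ->
  sup [set 2 * a * q + 4 * q * Num.sqrt ((1 - q) * q * (1 + a))
           - q ^+ 2 * (3 * a + 1) | q in `[2^-1, 1]] <=
  (a + Num.sqrt (a + 1)) ^+ 2 / (3 * a + 1).
Proof.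
move=> a0; set s := Num.sqrt (a + 1).
have s0 : 0 <= s by exact: sqrtr_ge0.
have ss : s ^+ 2 = a + 1 by rewrite sqr_sqrtr//; lra.
apply: ge_sup.
  by eexists; exists 1 => //=; rewrite in_itv/= lexx andbT invf_le1; lra.
move=> _ [q /= + <-]; rewrite in_itv/= => /andP[q2 q1].
set t := Num.sqrt _.
have ts : t <= s / 2.
  apply: sqrtr_ler_of_sqr; first lra.
  rewrite expr_div_n ss; have : (1 - q) * q <= 1 / 4 by nra.
  nra.
have k0 : 0 < 3 * a + 1 by lra.
have qk0 : 0 < q * (3 * a + 1) by rewrite mulr_gt0//; lra.
have : q * (3 * a + 1) * t <= q * (3 * a + 1) * (s / 2) by rewrite ler_pM2l.
have := sqr_ge0 (q * (3 * a + 1) - (a + s)).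
rewrite ler_pdivlMr//; clearbody t s; lra.
Qed.

(** The middle branch of [gamma_bar] equals the left side, and so does the bound on the [psi] term
    obtained from [sup_psi_le]. *)
Lemma gamma_bar_ge a0 a : 0 < a -> a < 2 ->
  a * (2 * a + 3 - 2 * Num.sqrt (a + 1)) / ((3 * a + 1) * (1 + a)) <=
  gamma_bar a0 a.
Proof.
move=> ap a2; rewrite /gamma_bar.
have := sup_psi_le ap; rewrite /psi; set M := sup _; set s := Num.sqrt (a + 1).
have ss : s ^+ 2 = a + 1 by rewrite sqr_sqrtr//; lra.
have s1 : 1 <= s by apply: ler_sqrtr_of_sqr; lra.
move=> Ms; case: ifP => _.
  rewrite invfM mulrA [leRHS]mulrC ler_pM2r ?invr_gt0; last lra.
  rewrite le_min; apply/andP; split.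
    by rewrite ler_pdivrMr; [nra|lra].
  apply: (@le_trans _ _ (1 + a - (a + s) ^+ 2 / (3 * a + 1))); last lra.
  rewrite le_eqVlt; apply/orP; left; apply/eqP.
  rewrite (_ : (a + s) ^+ 2 = a ^+ 2 + 2 * a * s + s ^+ 2); last ring.
  by rewrite ss; field; lra.
rewrite (ltW a2) le_eqVlt; apply/orP; left; apply/eqP.
by field; lra.
Qed.

(* The witness solves [g = a * max_r (rate g r)]; the maximiser is [sqrt a] for
   [a < 1] and the endpoint [1] otherwise. *)
Lemma exists_slope_threshold a0 a : 0 < a -> a < 2 ->
  exists2 g : R, 0 < g < gamma_bar a0 a &
    forall r, 0 < r -> r <= 1 -> a * rate g r <= g.
Proof.
move=> ap a2; have := @gamma_bar_ge a0 a ap a2; set s := Num.sqrt (a + 1).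
have ss : s ^+ 2 = a + 1 by rewrite sqr_sqrtr//; lra.
have s0 : 0 <= s by exact: sqrtr_ge0.
have s1 : s <= 1 + a / 2 by apply: sqrtr_ler_of_sqr; nra.
move=> gb; have [a1|a1] := ltP a 1.
  set t := Num.sqrt a.
  have t0 : 0 < t by rewrite sqrtr_gt0.
  have tt : t ^+ 2 = a by rewrite sqr_sqrtr// ltW.
  have t1 : t < 1 by nra.
  exists (a / (1 + t) ^+ 2).
    apply/andP; split; first by rewrite divr_gt0// exprn_gt0//; lra.
    (* The value [a / (3 * a + 1)] separates the two: [(1 + t) ^+ 2 > 3 * t ^+ 2 + 1] for
       [0 < t < 1], and [s <= 1 + a / 2]. *)
    apply: lt_le_trans gb; apply: (@lt_le_trans _ _ (a / (3 * a + 1))).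
      rewrite ltr_pM2l// ltf_pV2 ?posrE ?exprn_gt0//; [|lra|lra].
      by rewrite -tt; nra.
    have -> : a * (2 * a + 3 - 2 * s) / ((3 * a + 1) * (1 + a)) =
      a / (3 * a + 1) * ((2 * a + 3 - 2 * s) / (1 + a)) by field; lra.
    by rewrite ler_peMr ?divr_ge0 ?ler_pdivlMr//; lra.
  move=> r r0 r1; rewrite /rate ler_pM2l//.
  rewrite -subr_ge0 -tt.
  have -> : ((1 + t) ^+ 2)^-1 - ((1 + r)^-1 - t ^+ 2 / (1 + t) ^+ 2 / r) =
    (r - t) ^+ 2 / ((1 + t) ^+ 2 * (1 + r) * r) by field; lra.
  by rewrite divr_ge0 ?sqr_ge0// !mulr_ge0 ?sqr_ge0//; lra.
exists (a / (2 * (1 + a))).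
  apply/andP; split; first by rewrite divr_gt0//; lra.
  apply: lt_le_trans gb.
  rewrite -subr_gt0.
  (* The gap vanishes only at [s = 2], that is [a = 3], which [a < 2] excludes. *)
  have -> : a * (2 * a + 3 - 2 * s) / ((3 * a + 1) * (1 + a)) - a / (2 * (1 + a))
     = a * (s - 2) ^+ 2 / (2 * (3 * a + 1) * (1 + a)).
    rewrite (_ : (s - 2) ^+ 2 = s ^+ 2 - 4 * s + 4); last ring.
    by rewrite ss; field; lra.
  rewrite divr_gt0//; last by rewrite !mulr_gt0//; lra.
  by rewrite mulr_gt0//; nra.
move=> r r0 r1; rewrite /rate ler_pM2l//.
rewrite -subr_ge0.
have -> : (2 * (1 + a))^-1 - ((1 + r)^-1 - a / (2 * (1 + a)) / r) =
  (1 - r) * (a - r) / (2 * (1 + a) * (1 + r) * r) by field; lra.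
by rewrite divr_ge0// !mulr_ge0//; lra.
Qed.

End SpectrumReplication.

Unset Implicit Arguments.

Theorem mainTheorem5 (R : realType) (alpha gam : R) :
  0 < alpha -> 0 < gam ->
  (2 <= alpha -> gam = alpha / (2 * (1 + alpha))) ->
  [/\ (cc_bound alpha gam G - alpha * ln G) @[G --> +oo]
        --> alpha - (1 + alpha) * ln (1 + alpha),
      (sc_bound alpha gam G - alpha * ln G) @[G --> +oo]
        --> alpha * ln (gam / alpha) + alpha,
      (2 <= alpha ->
        (sr_bound alpha gam G - alpha * ln G) @[G --> +oo]
          --> alpha * ln (expR 1 / 8))
    & (alpha < 2 -> forall a0 : R, 0 < a0 -> alpha0_eq a0 = 0 ->
        exists2 c : R, 0 < c &
          (sr_bound alpha (gamma_bar a0 alpha) G / G) @[G --> +oo] --> c)].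
Proof.
move=> al0 gam0 gamE; split.
- exact: cvg_cc_bound.
- exact: cvg_sc_bound.
- by move=> al2; rewrite (gamE al2); exact: cvg_sr_bound.
move=> al2 a0 _ _; set g := gamma_bar a0 alpha.
have [h /andP[h0 hg] rate_le] := exists_slope_threshold a0 al0 al2.
have g0 : 0 < g := lt_trans h0 hg.
exists (g - Num.max (alpha * Lambda_rate g) 0); last exact: cvg_sr_bound_div.
(* Since [rate] decreases in its first argument and [h < g], the bound [alpha * rate h r <= h]
   passes to [rate g r], so the limit slope is at least [g - h] or equal to [g]. *)
rewrite subr_gt0 gt_max g0 andbT; apply: (le_lt_trans _ hg).
rewrite mulrC -ler_pdivlMr//; apply: Lambda_rate_le => r r0 r1.
rewrite ler_pdivlMr// mulrC; apply: le_trans (rate_le r r0 r1).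
rewrite ler_pM2l// lerD2l lerN2 ler_pM2r ?invr_gt0//.
exact: ltW.
Qed.
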